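(* Let $\{\tilde a_{ik}\}_{k\in\mathcal K_i}$ be a finite family of nonzero vectors in $\mathbb R^2$ (the retained directions), and let $a_{ij}\in\mathbb R^2$ be a nonzero vector with $a_{ij}\in\operatorname{cone}\{\tilde a_{ik}\}_{k\in\mathcal K_i}$. Then $a_{ij}$ admits a conic representation using at most two retained directions. If $a_{ij}$ lies on a retained ray $\tilde a_{ip}$, i.e. is positively collinear with $\tilde a_{ip}$, then $a_{ij}=\lambda_{jp}\tilde a_{ip}$ with $\lambda_{jp}\ge0$. Otherwise there exist two retained rays $\tilde a_{ip},\tilde a_{iq}$ whose angular separation satisfies $0<\Delta\theta_{pq}<\pi$ and whose cone contains $a_{ij}$, such that $$a_{ij}=\lambda_{jp}\tilde a_{ip}+\lambda_{jq}\tilde a_{iq},\qquad\lambda_{jp},\lambda_{jq}\ge0,$$ where the multipliers are given by $$\begin{bmatrix}\lambda_{jp}\\ \lambda_{jq}\end{bmatrix}=\begin{bmatrix}\tilde a_{ip}&\tilde a_{iq}\end{bmatrix}^{-1}a_{ij},$$ with $\lambda_{jk}=0$ for $k\notin\{p,q\}$.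
   Context: $\operatorname{cone}\{v_1,\dots,v_K\}=\{\sum_k\mu_kv_k:\mu_k\ge0\}$. The angular separation of two nonzero vectors is the angle between them in $[0,\pi]$. $[\tilde a_{ip}\ \tilde a_{iq}]$ is the $2\times2$ matrix with these columns. *)

(* Defs.v *)
From mathcomp Require Import all_boot all_order all_algebra.
From mathcomp Require Import all_classical all_reals all_analysis.

Set Implicit Arguments.
Unset Strict Implicit.
Unset Printing Implicit Defensive.

Import Order.TTheory GRing.Theory Num.Theory.

Local Open Scope ring_scope.
Local Open Scope classical_set_scope.

Definition dotv (R : realType) (n : nat) (u v : 'cV[R]_n) : R :=
  \sum_(i < n) u i 0 * v i 0.

(* The library's norm `|v| on matrices is the sup norm, hence this one. *)
Definition enorm (R : realType) (n : nat) (v : 'cV[R]_n) : R :=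
  Num.sqrt (dotv v v).

(* Meaningful for nonzero u and v only. *)
Definition angsep (R : realType) (n : nat) (u v : 'cV[R]_n) : R :=
  acos (dotv u v / (enorm u * enorm v)).

Definition conic_repr (R : realType) (n : nat) (K : finType)
    (v : K -> 'cV[R]_n) (x : 'cV[R]_n) (mu : K -> R) : Prop :=
  (forall k, 0 <= mu k) /\ x = \sum_k mu k *: v k.

Definition cone (R : realType) (n : nat) (K : finType)
    (v : K -> 'cV[R]_n) : set 'cV[R]_n :=
  [set x | exists mu : K -> R, conic_repr v x mu].

Definition pos_collinear (R : realType) (n : nat) (x v : 'cV[R]_n) : Prop :=
  exists2 c : R, 0 < c & x = c *: v.

(* Main.v *)
Require Import Defs.
From mathcomp Require Import all_boot all_order all_algebra.
From mathcomp Require Import all_classical all_reals all_analysis.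
From mathcomp Require Import ring.

Set Implicit Arguments.
Unset Strict Implicit.
Unset Printing Implicit Defensive.

Import Order.TTheory GRing.Theory Num.Theory.

Local Open Scope ring_scope.

(* A conic representation of minimal support is linearly independent on its
   support: subtracting a suitable multiple of a linear relation would kill a
   coefficient while keeping the others nonnegative. In the plane this leaves
   at most two directions, and if a is on no ray it leaves exactly two, with
   nonzero determinant; by Lagrange's identity the angle between them is then
   strictly between 0 and pi. *)

Lemma conic_repr_shrink (R : realType) (n : nat) (K : finType)
    (v : K -> 'cV[R]_n) (x : 'cV[R]_n) (mu d : K -> R) :
  conic_repr v x mu -> \sum_k d k *: v k = 0 ->
  (forall k, mu k = 0 -> d k = 0) -> (exists k, d k != 0) ->
  exists mu', conic_repr v x mu' /\
    ([set k | mu' k != 0] \proper [set k | mu k != 0])%SET.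
Proof.
move=> [mu0 xE] d0 dmu [k0 dk0].
(* The negated relation satisfies the same hypotheses, so some coefficient may be taken positive. *)
wlog dk0_gt0 : d d0 dmu dk0 / 0 < d k0.
  move=> H; have [dgt|] := boolP (0 < d k0); first exact: (H d).
  rewrite -leNgt le_eqVlt (negPf dk0) /= => dlt.
  apply: (H (fun k => - d k)); rewrite ?oppr_eq0 ?oppr_gt0 //.
  - under eq_bigr do rewrite scaleNr.
    by rewrite sumrN d0 oppr0.
  - by move=> k /dmu ->; rewrite oppr0.
(* Ratio test: [t], the least [mu k / d k] over [d k > 0], is the largest step that keeps every
   [mu k - t * d k] nonnegative, and the coefficient at the minimiser [m] becomes zero. Where
   [d k <= 0] the step only increases the coefficient. *)
have [m dm_gt0 mmin] :=
  @arg_minP _ R K k0 (fun k => 0 < d k) (fun k => mu k / d k) dk0_gt0.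
pose t := mu m / d m.
have t_ge0 : 0 <= t by rewrite divr_ge0 // ltW.
exists (fun k => mu k - t * d k); split; first split.
- move=> k; rewrite subr_ge0; have [dk|dk] := ltP 0 (d k).
    by rewrite -ler_pdivlMr //; exact: mmin.
  by apply: le_trans (mu0 k); rewrite mulr_ge0_le0.
- under eq_bigr do rewrite scalerBl -scalerA.
  by rewrite sumrB -scaler_sumr d0 scaler0 subr0.
apply/properP; split.
  apply/fintype.subsetP => k; rewrite !inE; apply: contraNneq => muk.
  by rewrite muk (dmu k muk) mulr0 subr0.
exists m; rewrite !inE.
  by apply: contraTneq dm_gt0 => /dmu ->; rewrite ltxx.
by rewrite negbK /t divfK ?subrr // gt_eqF.
Qed.

(** Linear independence of the vectors with nonzero coefficient. The relation [d] ranges over all of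
    [K] and is forced to vanish off the support, which avoids a subtype. *)
Definition free_on_support (R : realType) (n : nat) (K : finType)
    (v : K -> 'cV[R]_n) (mu : K -> R) : Prop :=
  forall d : K -> R, \sum_k d k *: v k = 0 ->
    (forall k, mu k = 0 -> d k = 0) -> forall k, d k = 0.

Lemma conic_repr_free (R : realType) (n : nat) (K : finType)
    (v : K -> 'cV[R]_n) (x : 'cV[R]_n) :
  cone v x -> exists mu, conic_repr v x mu /\ free_on_support v mu.
Proof.
move=> [mu].
(* Descent on the size of the support: a representation that is not free on its support can be
   shrunk strictly. *)
have [N] := ubnP #|[set k | mu k != 0%R]%SET|.
elim: N mu => // N IH mu muN rmu.
have [fmu|nfmu] := pselect (free_on_support v mu); first by exists mu.
have [d [d0 dmu dn0]] : exists d : K -> R, [/\ \sum_k d k *: v k = 0,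
    (forall k, mu k = 0 -> d k = 0) & exists k, d k != 0].
  apply: contrapT => nd; apply: nfmu => d d0 dmu k.
  by apply/eqP/negPn/negP => dk; apply: nd; exists d; split => //; exists k.
have [mu' [rmu' /proper_card lt]] := conic_repr_shrink rmu d0 dmu dn0.
by apply: (IH mu') => //; exact: leq_trans lt _.
Qed.

(** The supporting vectors, written as the rows of a matrix with [n] columns, are independent, so
    the number of rows is the rank and is at most [n]. *)
Lemma free_on_support_card (R : realType) (n : nat) (K : finType)
    (v : K -> 'cV[R]_n) (mu : K -> R) :
  free_on_support v mu -> (#|[set k | mu k != 0%R]%SET| <= n)%N.
Proof.
move=> fmu; set S := [set k | mu k != 0]%SET.
pose A : 'M[R]_(#|S|, n) := \matrix_(i, j) v (enum_val i) j 0.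
suff /eqP <- : row_free A by exact: rank_leq_col.
rewrite -kermx_eq0; apply/negPn/negP => /rowV0Pn [u /sub_kermxP uA /eqP].
apply.
(* Extension by zero to [K] of the kernel row [u], which is indexed by the enumeration of [S]. Since
   [enum_val] is injective, at most one term of the sum survives. *)
pose d k := \sum_(i < #|S|) (if k == enum_val i then u 0 i else 0).
have dS k : d k = 0.
  apply: fmu k => [|k muk]; last first.
    apply: big1 => i _; case: eqP => // kE.
    by have := enum_valP i; rewrite -kE inE muk eqxx.
  apply/colP => j; have /rowP/(_ j) := uA; rewrite !mxE summxE; apply: etrans.
  under [LHS]eq_bigr do rewrite mxE mulr_suml.
  rewrite exchange_big /=; apply: eq_bigr => i _.
  rewrite (bigD1 (enum_val i)) //= eqxx big1 ?addr0 ?mxE //.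
  by move=> k /negPf ->; rewrite mul0r.
apply/rowP => i; rewrite mxE -(dS (enum_val i)) /d (bigD1 i) //= eqxx.
rewrite big1 ?addr0 // => j ji; case: eqP => // /enum_val_inj ij.
by rewrite ij eqxx in ji.
Qed.

Lemma sum_pair (V : nmodType) (K : finType) (p q : K) (F : K -> V) :
  p != q -> (forall k, k \notin [:: p; q] -> F k = 0) ->
  \sum_k F k = F p + F q.
Proof.
move=> pq F0; rewrite (bigD1 p) //= (bigD1 q) 1?eq_sym //= big1 ?addr0 //.
by move=> k /andP[kp kq]; apply: F0; rewrite !inE negb_or kp.
Qed.

Lemma row_mx2E (R : realType) (u v : 'cV[R]_2) (i : 'I_2) :
  ((row_mx u v : 'M[R]_2) i 0 = u i 0) * ((row_mx u v : 'M[R]_2) i 1 = v i 0).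
Proof.
have e0 : (0 : 'I_2) = lshift 1 (0 : 'I_1) by apply: val_inj.
have e1 : (1 : 'I_2) = rshift 1 (0 : 'I_1) by apply: val_inj.
by rewrite e0 e1; split; [exact: row_mxEl | exact: row_mxEr].
Qed.

Lemma ord2_lift : lift ord0 ord0 = 1 :> 'I_2.
Proof. exact: val_inj. Qed.

Lemma mul_row_mx2 (R : realType) (u v w : 'cV[R]_2) :
  (row_mx u v : 'M[R]_2) *m w = w 0 0 *: u + w 1 0 *: v.
Proof.
apply/colP => i; rewrite mxE !big_ord_recl big_ord0 addr0 ord2_lift.
by rewrite !row_mx2E [RHS]mxE ![in RHS]mxE mulrC [X in _ + X]mulrC.
Qed.

Lemma det_row_mx2 (R : realType) (u v : 'cV[R]_2) :
  \det (row_mx u v : 'M[R]_2) = u 0 0 * v 1 0 - u 1 0 * v 0 0.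
Proof.
have cofE (A : 'M[R]_2) i j :
    cofactor A i j = (-1) ^+ (i + j) * A (lift i 0) (lift j 0).
  by rewrite /cofactor det_mx11 !mxE.
rewrite (expand_det_row _ 0) !big_ord_recl big_ord0 addr0 ord2_lift !cofE.
have -> : lift ord0 0 = 1 :> 'I_2 by exact: val_inj.
have -> : lift 1 0 = 0 :> 'I_2 by exact: val_inj.
by rewrite !row_mx2E /= expr0 expr1; ring.
Qed.

Lemma angsep_gt0_ltpi (R : realType) (u v : 'cV[R]_2) :
  (row_mx u v : 'M[R]_2) \in unitmx -> 0 < angsep u v < pi.
Proof.
rewrite unitmxE unitfE det_row_mx2 => det0.
have lagrange : dotv u u * dotv v v =
    dotv u v ^+ 2 + (u 0 0 * v 1 0 - u 1 0 * v 0 0) ^+ 2.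
  rewrite /dotv !big_ord_recl !big_ord0.
  by rewrite ord2_lift; ring.
have dot_ge0 (w : 'cV[R]_2) : 0 <= dotv w w.
  by apply: sumr_ge0 => i _; rewrite -expr2 sqr_ge0.
(* The nonzero determinant makes Cauchy-Schwarz strict. This gives both nonzero norms and a cosine
   strictly between -1 and 1. *)
have lt : dotv u v ^+ 2 < dotv u u * dotv v v.
  by rewrite lagrange ltrDl exprn_even_gt0.
have pos : 0 < enorm u * enorm v.
  by rewrite -sqrtrM // sqrtr_gt0; apply: le_lt_trans lt; exact: sqr_ge0.
have : `|dotv u v / (enorm u * enorm v)| < 1.
  rewrite normrM normfV (gtr0_norm pos) ltr_pdivrMr // mul1r.
  by rewrite -sqrtrM // -sqrtr_sqr ltr_sqrt //; apply: le_lt_trans lt; exact: sqr_ge0.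
rewrite ltr_norml => /andP[lo hi].
by rewrite /angsep acos_gt0 ?(ltW lo) ?hi //= acos_ltpi ?lo ?(ltW hi).
Qed.


Theorem mainTheorem6 (R : realType) (K : finType) (atilde : K -> 'cV[R]_2)
    (a : 'cV[R]_2) (hatilde : forall k : K, atilde k != 0) (ha : a != 0)
    (hcone : cone atilde a) :
  [/\ (exists lam : K -> R,
         conic_repr atilde a lam /\ (#|[set k | lam k != 0%R]%SET| <= 2)%N),
      (forall p : K, pos_collinear a (atilde p) ->
         exists lam : K -> R,
           [/\ conic_repr atilde a lam,
               a = lam p *: atilde p,
               0 <= lam p
             & forall k : K, k != p -> lam k = 0])
    & (~ (exists p : K, pos_collinear a (atilde p)) ->
         exists (p q : K) (lam : K -> R),
           [/\ 0 < angsep (atilde p) (atilde q) < pi,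
               cone (fun k : 'I_2 => atilde (tnth [tuple p; q] k)) a,
               conic_repr atilde a lam,
               a = lam p *: atilde p + lam q *: atilde q
             & [/\ 0 <= lam p, 0 <= lam q,
                   (row_mx (atilde p) (atilde q) : 'M[R]_2) \in unitmx,
                   \col_(k < 2) lam (tnth [tuple p; q] k)
                     = invmx (row_mx (atilde p) (atilde q) : 'M[R]_2) *m a
                 & forall k : K, k \notin [:: p; q] -> lam k = 0]])].
Proof.
have [mu [rmu fmu]] := conic_repr_free hcone.
have card2 := free_on_support_card fmu.
split; first by exists mu.
  (* [mu] may be supported on other rays even when [a] lies on the ray of [p], so a representation
     concentrated at [p] is built afresh. *)
  move=> p [c c_gt0 aE]; exists (fun k => if k == p then c else 0).
  have lamE : \sum_k (if k == p then c else 0) *: atilde k = c *: atilde p.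
    rewrite (bigD1 p) //= eqxx big1 ?addr0 // => k /negPf ->.
    by rewrite scale0r.
  split=> [|||k /negPf -> //]; rewrite ?eqxx ?(ltW c_gt0) //.
  by split=> [k|]; [case: ifP => // _; exact: ltW | rewrite lamE].
move=> nray; have [mu_ge0 aE] := rmu.
set S := [set k | mu k != 0]%SET in card2.
have mu0 k : k \notin S -> mu k = 0 by rewrite inE negbK => /eqP.
(* An empty support would give [a = 0], and a singleton would put [a] on a retained ray. *)
have /cards2P [p [q [pq SE]]] : #|S| == 2%N.
  rewrite eqn_leq card2 /= leqNgt; apply/negP; rewrite ltnS leq_eqVlt.
  move=> /orP[/cards1P [p SE]|]; last first.
    rewrite ltnS leqn0 cards_eq0 => /eqP SE; move/eqP: ha; apply.
    by rewrite aE big1 // => k _; rewrite mu0 ?scale0r // SE inE.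
  apply: nray; exists p, (mu p).
    by rewrite lt_def mu_ge0 andbT; have := set11 p; rewrite -SE inE.
  rewrite {1}aE (bigD1 p) //= big1 ?addr0 // => k kp.
  by rewrite mu0 ?scale0r // SE inE.
have mupq k : k \notin [:: p; q] -> mu k = 0.
  by move=> kpq; apply: mu0; rewrite SE !inE in kpq *.
have apq : a = mu p *: atilde p + mu q *: atilde q.
  rewrite {1}aE (sum_pair pq) // => k /mupq ->; exact: scale0r.
have unitM : (row_mx (atilde p) (atilde q) : 'M[R]_2) \in unitmx.
  (* A singular matrix would have a nonzero kernel vector; transposing yields it as a row [w]. Its
     two entries, placed at [p] and [q], form a linear relation on the support of [mu], so freeness
     makes them zero. *)
  rewrite unitmxE unitfE -det_tr; apply/det0P => -[w w0 wM].
  pose d k := if k == p then w 0 0 else if k == q then w 0 1 else 0.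
  have dp : d p = w 0 0 by rewrite /d eqxx.
  have dq : d q = w 0 1 by rewrite /d eq_sym (negPf pq) eqxx.
  have dpq k : k \notin [:: p; q] -> d k = 0.
    by rewrite !inE negb_or /d => /andP[/negPf -> /negPf ->].
  have d0 : forall k, d k = 0.
    apply: fmu => [|k muk]; last first.
      apply: dpq; apply: contraTN isT => kpq.
      by have : k \in S; [rewrite SE !inE in kpq * | rewrite inE muk eqxx].
    rewrite (sum_pair pq) => [|k /dpq ->]; last exact: scale0r.
    have := mul_row_mx2 (atilde p) (atilde q) w^T.
    by rewrite !mxE -dp -dq => <-; rewrite -[LHS]trmxK trmx_mul trmxK wM trmx0.
  move/eqP: w0; apply; apply/rowP => i; rewrite mxE.
  case: (unliftP 0 i) => [j ->|->]; last by rewrite -dp d0.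
  by rewrite (ord1 j) -(d0 q) dq; congr (w _ _); apply: val_inj.
exists p, q, mu; split => //; first exact: angsep_gt0_ltpi.
  exists (fun k => mu (tnth [tuple p; q] k)); split=> [k|]; first exact: mu_ge0.
  by rewrite !big_ord_recl big_ord0 addr0 !(tnth_nth p).
(* The inverse formula is [apq] read as the matrix times the column of multipliers. *)
split => //; apply: (canRL (mulKmx unitM)).
by rewrite mul_row_mx2 !mxE !(tnth_nth p).
Qed.
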